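(* Let $K$ be an algebraically closed field, $X\subset\mathbb{A}^m_K$ a closed subscheme, and $D\ge0$ an integer. Then there exists $C=C(X,D)>0$ such that for every $N>0$ and all polynomials $F_1,\ldots,F_N\in K[X_1,\ldots,X_m]$ of degree at most $D$, one has $N(X,\mathcal{S})\le C\cdot N^{\dim X}$, where $\mathcal{S}=\{Y_1,\ldots,Y_N\}$ and $Y_i$ is the intersection of $X$ with the hypersurface $F_i=0$.
   Context: For a scheme $X$ of finite type over $K$ and a finite set $\mathcal{S}$ of closed subschemes of $X$, for $\sigma\in\{0,1\}^{\mathcal{S}}$ let $\mathrm{R}(\sigma)=\{x\in X(K)\mid\forall Y\in\mathcal{S},\ x\in Y\Leftrightarrow\sigma(Y)=1\}$, $\Sigma(X,\mathcal{S})=\{\sigma\mid\mathrm{R}(\sigma)\ne\emptyset\}$, and $N(X,\mathcal{S})=\mathrm{card}\,\Sigma(X,\mathcal{S})$ (the number of realizable $0/1$-patterns). *)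

(* Defs.v *)
From HB Require Import structures.
From mathcomp Require Import all_boot all_order all_algebra.
From mathcomp Require Import ring_quotient finmap.
From mathcomp Require Import boolp classical_sets reals.
From mathcomp Require Import mpoly.

Set Implicit Arguments.
Unset Strict Implicit.
Unset Printing Implicit Defensive.

Import GRing.Theory.
Local Open Scope ring_scope.
Local Open Scope classical_set_scope.

(* [idealr_closed] of the library also demands 1 \notin I. The unit ideal has
   to be allowed here: it cuts out the empty subscheme. *)
Definition ideal_closed (A : comNzRingType) (I : {pred A}) : Prop :=
  0 \in I /\ forall a : A, {in I &, forall u v, a * u + v \in I}.

(* The closed subschemes of the affine scheme A^m_K = Spec K[X_1, ..., X_m]
   correspond one to one to the ideals of K[X_1, ..., X_m]. *)
Record subscheme (K : closedFieldType) (m : nat) := Subscheme {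
  ideal_of : {pred {mpoly K[m]}};
  ideal_ofP : ideal_closed ideal_of }.

(* Classical equality and choice, so that finite sets {fset subscheme K m} of
   subschemes can be formed. *)
HB.instance Definition _ K m := gen_eqMixin (subscheme K m).
HB.instance Definition _ K m := gen_choiceMixin (subscheme K m).

Section Subschemes.
Variables (K : closedFieldType) (m : nat).
Implicit Types (X Y : subscheme K m) (f g : {mpoly K[m]}).

Definition principal f : {pred {mpoly K[m]}} :=
  fun g => `[< exists h, g = h * f >].

Lemma principal_closed f : ideal_closed (principal f).
Proof.
split; first by apply/asboolP; exists 0; rewrite mul0r.
move=> a u v /asboolP[h ->] /asboolP[k ->]; apply/asboolP.
by exists (a * h + k); rewrite mulrDl mulrA.
Qed.

Definition hypersurface f : subscheme K m := Subscheme (principal_closed f).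

(* The scheme-theoretic intersection, cut out by the sum of the ideals. *)
Definition inter_ideal X Y : {pred {mpoly K[m]}} :=
  fun f => `[< exists g h, [/\ g \in ideal_of X, h \in ideal_of Y
                             & f = g + h] >].

Lemma inter_closed X Y : ideal_closed (inter_ideal X Y).
Proof.
have [[X0 XD] [Y0 YD]] := (ideal_ofP X, ideal_ofP Y).
split; first by apply/asboolP; exists 0, 0; rewrite addr0.
move=> a u v /asboolP[g [h [gX hY ->]]] /asboolP[g' [h' [gX' hY' ->]]].
apply/asboolP; exists (a * g + g'), (a * h + h'); split; [exact: XD|exact: YD|].
by rewrite mulrDr addrACA.
Qed.

Definition inter X Y : subscheme K m := Subscheme (inter_closed X Y).

(* The K-points X(K), as a subset of A^m(K) = K^m. *)
Definition points X : set ('I_m -> K) :=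
  [set x | forall f, f \in ideal_of X -> f.@[x] = 0].

(* The points of the affine scheme X, i.e. its irreducible closed subsets, are
   the prime ideals containing the ideal of X. *)
Definition prime_chain X (n : nat) : Prop :=
  exists P : 'I_n -> prime_idealr {mpoly K[m]},
    (forall i, {subset ideal_of X <= (P i : pred _)}) /\
    (forall i j : 'I_n, (i < j)%N ->
       {subset (P i : pred _) <= (P j : pred _)} /\
       exists2 f, f \in (P j : pred _) & f \notin (P i : pred _)).

(* The Krull dimension: a chain P_0 < ... < P_l of l.+1 primes has length l.
   The empty subscheme, which only has the chain without any prime, has
   dimension -1. *)
Definition has_dim X (d : int) : Prop :=
  exists n : nat, [/\ d = n%:Z - 1, prime_chain X n
    & forall k : nat, prime_chain X k -> (k <= n)%N].

Definition pattern_set X (S : {fset subscheme K m}) (s : {ffun S -> bool}) :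
    set ('I_m -> K) :=
  [set x | points X x /\ forall Y : S, points (val Y) x <-> s Y = true].

Definition realizable_patterns X (S : {fset subscheme K m}) :
    {set {ffun S -> bool}} :=
  [set s | `[< pattern_set X s !=set0 >]]%SET.

Definition pattern_count X (S : {fset subscheme K m}) : nat :=
  #|realizable_patterns X S|.

End Subschemes.

(* Main.v *)
Require Import Defs.
From HB Require Import structures.
From mathcomp Require Import all_boot all_order all_algebra.
From mathcomp Require Import ring_quotient finmap generic_quotient.
From mathcomp Require Import boolp classical_sets reals.
From mathcomp Require Import mpoly zify.

(* Let I be the ideal of X, and call a set U of variables independent if I
   meets K[U] only in 0; let r be the largest size of an independent set.

   Patterns (Ronyai, Babai, Ganapathy): choose a witness x_s for each pattern
   s, and let g_s be the product of the F_i not vanishing at x_s. The matrix of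
   the g_s(x_t) is triangular for inclusion of supports, so the g_s are linearly
   independent on X(K), and there are at most as many patterns as monomials in
   a set spanning the polynomials of degree <= N D modulo I.

   Spanning monomials: every set V of r + 1 variables carries a relation
   f_V != 0 in I. Dividing by the leading monomials of the f_V, for a graded
   order, leaves only monomials in which at most r exponents are large, and
   there are O(n^r) of these in degree <= n.

   Dimension: an independent set of r variables yields a chain of r + 1 primes.
   Take a prime P over I with U independent for P, enlarged to a maximal such
   set, and u in U. Over a localization K[U][1/s] the quotient by P is integral,
   so for every c such that s does not vanish at X_u = c the set U \ u is
   independent for P + (X_u - c), and induction applies. Thus r <= dim X. *)

Local Open Scope ring_scope.

Set Implicit Arguments.
Unset Strict Implicit.
Unset Printing Implicit Defensive.
Import Order.TTheory GRing.Theory Num.Theory.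

(** * Polynomials in a subset of the variables *)

Section Restriction.
Variables (K : idomainType) (m : nat).
Implicit Types (U V : {set 'I_m}) (u : 'I_m) (f : {mpoly K[m]}).

Lemma eq_mpoly_morphism (S : nzRingType) (p q : {rmorphism {mpoly K[m]} -> S}) :
  (forall c, p c%:MP = q c%:MP) -> (forall i, p 'X_i = q 'X_i) -> p =1 q.
Proof.
move=> pqC pqX f; rewrite (mpolyE f) !rmorph_sum; apply: eq_bigr => b _.
rewrite -mul_mpolyC !rmorphM pqC mpolyXE_id !rmorph_prod; congr (_ * _).
by apply: eq_bigr => i _; rewrite !rmorphXn pqX.
Qed.

(* K[U] is encoded as the set of polynomials fixed by the substitution
   X_i := 0 for i outside U. *)
Definition restr U : {rmorphism {mpoly K[m]} -> {mpoly K[m]}} :=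
  mmap (@mpolyC m K) (fun i => if i \in U then 'X_i else 0).

Definition poly_in U f := restr U f == f.

Lemma restrC U c : restr U c%:MP = c%:MP.
Proof. exact: mmapC. Qed.

Lemma restrXU U i : restr U 'X_i = if i \in U then 'X_i else 0.
Proof. by rewrite /restr /= mmapX mmap1U. Qed.

(** The substitution keeps a monomial supported in [U] and kills every other one, so a fixed
    polynomial carries only monomials of the first kind. *)
Lemma mem_msupp_poly_in U f b i :
  poly_in U f -> b \in msupp f -> i \notin U -> b i = 0%N.
Proof.
move=> /eqP <- + iU; apply: contraTeq => bi.
rewrite mcoeff_msupp negbK /restr /= /mmap raddf_sum big1_seq //= => b' _.
rewrite mcoeffCM; have [b'i|b'i] := eqVneq (b' i) 0%N; last first.
  by rewrite /mmap1 (bigD1 i) //= (negPf iU) expr0n (negPf b'i) mul0r mcoeff0 mulr0.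
have : (mmap1 (fun j => if j \in U then 'X_j else 0 : {mpoly K[m]}) b')
   = if [forall j, (j \notin U) ==> (b' j == 0%N)] then 'X_[b'] else 0.
  case: ifP => [/forallP h|/forallPn[j]].
    rewrite mpolyXE_id; apply: eq_bigr => j _; have := h j.
    by case: ifP => //= _ /eqP ->; rewrite !expr0.
  rewrite negb_imply => /andP[jU b'j].
  by rewrite /mmap1 (bigD1 j) //= (negPf jU) expr0n (negPf b'j) mul0r.
move=> ->; case: ifP => _; last by rewrite mcoeff0 mulr0.
rewrite mcoeffX; case: eqP => [eb|_]; last by rewrite mulr0.
by rewrite -eb b'i eqxx in bi.
Qed.

Opaque restr.

Lemma restr_restr U V f : restr U (restr V f) = restr (U :&: V) f.
Proof.
pose p : {rmorphism _ -> _} := restr U \o restr V.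
apply: (@eq_mpoly_morphism _ p (restr (U :&: V))) => [c|i].
  by rewrite /= !restrC.
rewrite /= !restrXU inE; case: ifP; rewrite ?andbT ?andbF ?rmorph0 //.
by rewrite restrXU.
Qed.

Lemma poly_in_restr U f : poly_in U (restr U f).
Proof. by rewrite /poly_in restr_restr finset.setIid. Qed.

Lemma poly_inS U V f : U \subset V -> poly_in U f -> poly_in V f.
Proof.
by move=> /finset.setIidPr UV /eqP <-; rewrite /poly_in restr_restr UV.
Qed.

Lemma poly_in0 f : poly_in finset.set0 f -> f = (f@_0)%:MP.
Proof.
move=> f0; apply: msize1_polyC; rewrite msizeE.
apply/bigmax_leqP_seq => b bf _; rewrite ltnS leqn0 mdeg_eq0.
by apply/eqP/mnmP => i; rewrite mnm0E; apply: mem_msupp_poly_in f0 bf _; rewrite inE.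
Qed.

(* K[X_1, ..., X_m] viewed as a polynomial ring in the variable X_u. *)
Definition uni u : {rmorphism {mpoly K[m]} -> {poly {mpoly K[m]}}} :=
  mmap (polyC \o @mpolyC m K) (fun i => if i == u then 'X else ('X_i)%:P).

Lemma uniC u c : uni u c%:MP = (c%:MP)%:P.
Proof. by rewrite /uni /= mmapC. Qed.

Lemma uniXU u i : uni u 'X_i = if i == u then 'X else ('X_i)%:P.
Proof. by rewrite /uni /= mmapX mmap1U. Qed.

Opaque uni.

Lemma horner_uni u f : (uni u f).['X_u] = f.
Proof.
pose p : {rmorphism _ -> _} := horner_eval ('X_u : {mpoly K[m]}) \o uni u.
pose q : {rmorphism {mpoly K[m]} -> _} := idfun.
apply: (@eq_mpoly_morphism _ p q) => [c|i]; rewrite /= /horner_eval ?uniC ?hornerC //.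
by rewrite uniXU; case: eqP => [->|_]; rewrite ?hornerX ?hornerC.
Qed.

Lemma uni_eq0 u f : (uni u f == 0) = (f == 0).
Proof.
apply/eqP/eqP => [h|->]; last exact: rmorph0.
by rewrite -(horner_uni u f) h horner0.
Qed.

(** Restricting coefficients to [U] after [uni u] agrees with [uni u] after restriction to [u |: U]:
    both are morphisms, equal on the variables. *)
Lemma uni_coef_in u U f j : u \notin U -> poly_in (u |: U) f ->
  poly_in U (uni u f)`_j.
Proof.
move=> uU /eqP fU; rewrite /poly_in -coef_map.
pose p : {rmorphism {mpoly K[m]} -> {poly {mpoly K[m]}}} :=
  map_poly (restr U) \o uni u.
pose q : {rmorphism _ -> _} := uni u \o restr (u |: U).
suff pq : p =1 q by have /= -> := pq f; rewrite fU.
apply: eq_mpoly_morphism => [c|i] /=.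
  by rewrite restrC uniC map_polyC /= restrC.
rewrite restrXU uniXU !inE; have [->|iu] := eqVneq i u.
  by rewrite map_polyX uniXU eqxx.
rewrite map_polyC /= restrXU; case: ifP => _ //=; last by rewrite !rmorph0.
by rewrite uniXU (negPf iu).
Qed.

Lemma uni_const u U f : u \notin U -> poly_in U f -> uni u f = f%:P.
Proof.
move=> uU /eqP fU.
pose p : {rmorphism {mpoly K[m]} -> {poly {mpoly K[m]}}} := uni u \o restr U.
pose q : {rmorphism {mpoly K[m]} -> {poly {mpoly K[m]}}} := polyC \o restr U.
suff pq : p =1 q by have /= := pq f; rewrite fU.
apply: eq_mpoly_morphism => [c|i] /=; first by rewrite !restrC uniC.
rewrite !restrXU; case: ifP => iU; last by rewrite !rmorph0.
by rewrite uniXU; case: eqP => // iu; rewrite -iu iU in uU.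
Qed.

End Restriction.
Arguments restr {K m} U.
Arguments uni {K m} u.

(** An algebraically closed field is infinite, so it offers more constants than [p] can have
    roots. *)
Lemma exists_nonroot_const (K : closedFieldType) m (p : {poly {mpoly K[m]}}) :
  p != 0 -> exists c : K, p.[c%:MP] != 0.
Proof.
move=> p0; apply: contrapT => /forallNP h.
have [rs rs_uniq rs_size] : exists2 rs : seq K, uniq rs & size rs = size p.
  elim: (size p) => [|n [rs rsu rsn]]; first by exists [::].
  have /closed_nonrootP[c] : \prod_(r <- rs) ('X - r%:P) != 0.
    by rewrite monic_neq0 // monic_prod_XsubC.
  by rewrite root_prod_XsubC => crs; exists (c :: rs); rewrite /= ?rsn // crs.
have /max_poly_roots : p != 0 by [].
move=> /(_ [seq c%:MP | c <- rs]); rewrite size_map rs_size ltnn.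
suff [-> -> ] : all (root p) [seq c%:MP | c <- rs] /\ uniq [seq c%:MP_[m] | c <- rs].
  by move=> /(_ isT isT).
split; last by rewrite map_inj_uniq //; exact: can_inj (@mpolyCK _ _).
apply/allP => _ /mapP[c _ ->]; rewrite rootE.
by have := h c; case: eqP => // _ /(_ isT).
Qed.

Section PolyIn.
Variables (K : idomainType) (m : nat) (U : {set 'I_m}).
Implicit Types f g : {mpoly K[m]}.

Lemma poly_inC c : poly_in U (c%:MP : {mpoly K[m]}).
Proof. by rewrite /poly_in restrC. Qed.

Lemma poly_inX i : i \in U -> poly_in U ('X_i : {mpoly K[m]}).
Proof. by rewrite /poly_in restrXU => ->. Qed.

Lemma poly_in_nat n : poly_in U (n%:R : {mpoly K[m]}).
Proof. by rewrite /poly_in rmorph_nat. Qed.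

Lemma poly_inD f g : poly_in U f -> poly_in U g -> poly_in U (f + g).
Proof. by rewrite /poly_in rmorphD => /eqP -> /eqP ->. Qed.

Lemma poly_inB f g : poly_in U f -> poly_in U g -> poly_in U (f - g).
Proof. by rewrite /poly_in rmorphB => /eqP -> /eqP ->. Qed.

Lemma poly_inM f g : poly_in U f -> poly_in U g -> poly_in U (f * g).
Proof. by rewrite /poly_in rmorphM => /eqP -> /eqP ->. Qed.

Lemma poly_in_exp f n : poly_in U f -> poly_in U (f ^+ n).
Proof. by rewrite /poly_in rmorphXn => /eqP ->. Qed.

Lemma poly_in_sum (I : Type) (r : seq I) (P : pred I) (F : I -> {mpoly K[m]}) :
  (forall i, P i -> poly_in U (F i)) -> poly_in U (\sum_(i <- r | P i) F i).
Proof.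
by move=> UF; rewrite /poly_in rmorph_sum; apply/eqP/eq_bigr => i /UF /eqP.
Qed.

Lemma poly_in_prod (I : Type) (r : seq I) (P : pred I) (F : I -> {mpoly K[m]}) :
  (forall i, P i -> poly_in U (F i)) -> poly_in U (\prod_(i <- r | P i) F i).
Proof.
by move=> UF; rewrite /poly_in rmorph_prod; apply/eqP/eq_bigr => i /UF /eqP.
Qed.

End PolyIn.

(** * Ideals meeting K[U] only in 0, and primes above them *)

Section Ideals.
Variables (K : closedFieldType) (m : nat).
Implicit Types (X : subscheme K m) (U V : {set 'I_m}) (f g : {mpoly K[m]}).

Lemma ideal0 X : 0 \in ideal_of X.
Proof. by have [] := ideal_ofP X. Qed.

Lemma idealD X f g : f \in ideal_of X -> g \in ideal_of X -> f + g \in ideal_of X.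
Proof. by have [_ h] := ideal_ofP X => fX gX; rewrite -[f]mul1r h. Qed.

Lemma idealM X a f : f \in ideal_of X -> a * f \in ideal_of X.
Proof. by have [X0 h] := ideal_ofP X => fX; rewrite -[a * f]addr0 h. Qed.

Lemma ideal_inter_hypersurface X f : f \in ideal_of (inter X (hypersurface f)).
Proof.
apply/asboolP; exists 0, f; rewrite add0r; split=> //; first exact: ideal0.
by apply/asboolP; exists 1; rewrite mul1r.
Qed.

Lemma sub_inter X Y : {subset ideal_of X <= ideal_of (inter X Y)}.
Proof.
move=> f fX; apply/asboolP; exists f, 0; rewrite addr0; split=> //.
exact: ideal0.
Qed.

Definition independent X U :=
  forall f, f \in ideal_of X -> poly_in U f -> f = 0.

Lemma independentS X U V : U \subset V -> independent X V -> independent X U.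
Proof. by move=> UV iV f fX /(poly_inS UV); exact: iV. Qed.

Lemma independent1 X U : independent X U -> 1 \notin ideal_of X.
Proof.
move=> iU; apply/negP => /iU; rewrite -mpolyC1 => /(_ (poly_inC _ _))/eqP.
by rewrite mpolyC_eq0 oner_eq0.
Qed.

(* Krull: an ideal maximal among those meeting K[U] only in 0 is prime. *)
Lemma prime_over X U : independent X U ->
  exists P : prime_idealr {mpoly K[m]}, {subset ideal_of X <= (P : pred _)} /\
    forall f, f \in (P : pred _) -> poly_in U f -> f = 0.
Proof.
move=> iU; pose I : set {mpoly K[m]} := [set f | f \in ideal_of X]%classic.
pose ideal (A : set {mpoly K[m]}) :=
  A 0 /\ forall a u v, A u -> A v -> A (a * u + v).
pose good A := ideal A /\ forall f, A f -> poly_in U f -> f = 0.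
have I_good : good I.
  split=> //; split=> [|a u v uX vX]; first exact: ideal0.
  by apply: idealD => //; exact: idealM.
(* The empty chain needs a bound too: testing the union of A and I instead of A lets the empty union
   stand for the ideal of [X]. *)
have [|A [[[A0 AD] AU] Amax]] :=
  @Zorn_bigcup _ [set A | good (A `|` I)]%classic.
  move=> F Fgood Ftot /=; set W := (_ `|` _)%classic.
  have common u v : W u -> W v -> exists A, [/\ good (A `|` I)%classic,
    (A `|` I)%classic u, (A `|` I)%classic v & (A `|` I `<=` W)%classic].
    have sub A : F A -> (A `|` I `<=` W)%classic.
      by move=> FA x [Ax|Ix]; [left; exists A|right].
    move=> [[A FA Au]|Iu] [[B FB Bv]|Iv].
    - have [AB|BA] := Ftot _ _ FA FB.
        by exists B; split; [exact: Fgood|left; exact: AB|left|exact: sub].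
      by exists A; split; [exact: Fgood|left|left; exact: BA|exact: sub].
    - by exists A; split; [exact: Fgood|left|right|exact: sub].
    - by exists B; split; [exact: Fgood|right|left|exact: sub].
    - exists set0; rewrite set0U; split => //.
      by move=> x Ix; right.
  split; [split|].
  - by right; exact: ideal0.
  - move=> a u v Wu Wv; have [A [[[_ AD] _] Au Av]] := common u v Wu Wv.
    apply; exact: AD.
  - by move=> f Wf; have [A [[_ AU] Af _ _]] := common f f Wf Wf; exact: AU.
pose Q := (A `|` I)%classic.
have Qmul a u : Q u -> Q (a * u) by move=> Qu; rewrite -[_ * _]addr0; exact: AD.
have Qplus u v : Q u -> Q v -> Q (u + v).
  by move=> Qu Qv; rewrite -[u]mul1r; exact: AD.
(* By maximality the ideal generated by [Q] and [f] meets K[U] outside 0. *)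
have escape f : ~ Q f -> exists a q s, [/\ Q q, s = a * f + q, poly_in U s & s != 0].
  move=> Qf; apply: contrapT => no_s.
  pose B : set {mpoly K[m]} := [set s | exists a q, Q q /\ s = a * f + q]%classic.
  have QB : (Q `<=` B)%classic by move=> q Qq; exists 0, q; rewrite mul0r add0r.
  apply: (Amax B).
    split=> [x Ax|BA]; first by apply: QB; left.
    by apply: Qf; left; apply: BA; exists 1, 0; rewrite mul1r addr0.
  rewrite /= (_ : B `|` I = B)%classic; last by apply/setUidPl => x Ix; apply: QB; right.
  split; [split|].
  - exact: QB.
  - move=> a _ _ [b [q [Qq ->]]] [b' [q' [Qq' ->]]].
    exists (a * b + b'), (a * q + q'); split; first exact: AD.
    by rewrite mulrDr addrACA mulrDl mulrA.
  - move=> s [a [q [Qq sE]]] sU; apply/eqP/negP => s0; apply: no_s.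
    by exists a, q, s; split=> //; apply/negP.
pose S : {pred {mpoly K[m]}} := fun f => `[< Q f >].
have S_idealr : idealr_closed S.
  split; first exact/asboolP.
    apply/asboolPn => Q1; have := AU _ Q1.
    rewrite -mpolyC1 => /(_ (poly_inC _ _))/eqP.
    by rewrite mpolyC_eq0 oner_eq0.
  by move=> a u v /asboolP Qu /asboolP Qv; apply/asboolP; exact: AD.
have S_prime : prime_idealr_closed S.
  move=> f g /asboolP Qfg; apply/orP; apply: contrapT => /not_orP[fS gS].
  have [|a [q [s [Qq sE sU s0]]]] := escape f; first by move=> /asboolP.
  have [|b [r [t [Qr tE tU t0]]]] := escape g; first by move=> /asboolP.
  (* In the expansion of (a f + q)(b g + r) every term is in [Q], because f g is; so s t lies in
     both [Q] and K[U]. *)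
  have /eqP : s * t = 0.
    apply: AU; last exact: poly_inM.
    rewrite [in X in X * t]sE mulrDl {1}tE mulrDr -!addrA.
    rewrite [a * f * _]mulrACA; apply: (Qplus) (Qmul _ _ Qfg) _.
    by apply: Qplus; [exact: Qmul|rewrite mulrC; exact: Qmul].
  by rewrite mulf_eq0 (negPf s0) (negPf t0).
pose P : prime_idealr {mpoly K[m]} := HB.pack S
  (isIdealr.Build _ S S_idealr) (isPrimeIdealrClosed.Build _ S S_prime).
exists P; split=> [f fX|f /asboolP]; last exact: AU.
by apply/asboolP; right.
Qed.

Lemma prime_ideal_closed (P : prime_idealr {mpoly K[m]}) :
  ideal_closed (P : {pred _}).
Proof.
split; first exact: idealr0.
by move=> a u v uP vP; rewrite rpredD // idealMr.
Qed.

End Ideals.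

(** * Independent sets of variables and chains of primes *)

Section Slicing.
Variables (K : closedFieldType) (m : nat) (X : subscheme K m) (U : {set 'I_m}).
Hypothesis X_U : independent X U.
Implicit Types (f g h : {mpoly K[m]}).

Let S : {pred {mpoly K[m]}} := ideal_of X.

Let S_idealr_closed : idealr_closed S.
Proof.
split; [exact: ideal0|exact: independent1 X_U|] => a u v uX vX.
by apply: idealD => //; exact: idealM.
Qed.

Let I : idealr {mpoly K[m]} := HB.pack S (isIdealr.Build _ S S_idealr_closed).

Let A : comNzRingType := {ideal_quot I}.

Let pr : {rmorphism {mpoly K[m]} -> A} := \pi_({ideal_quot I})%qT.

Let pr_eq0 f : (pr f == 0) = (f \in ideal_of X).
Proof. by rewrite -(rmorph0 pr) -Quotient.idealrBE subr0. Qed.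

(** Integrality over the subring K[U] is expressed by letting all polynomials act through
    [restr U]. *)
Let res : {rmorphism {mpoly K[m]} -> A} := pr \o restr U.

Let integral_in f : poly_in U f -> integralOver res (pr f).
Proof. by move=> /eqP fU; rewrite -fU; exact: integral_id. Qed.

Let map_poly_res (p : {poly {mpoly K[m]}}) : (forall j, poly_in U p`_j) ->
  map_poly res p = map_poly pr p.
Proof.
by move=> pU; apply/polyP => j; rewrite !coef_map /=; have /eqP -> := pU j.
Qed.

(** A relation c X_i^(n+1) + ... = 0 over K[U], multiplied by c^n, becomes a monic equation for c
    X_i. *)
Lemma integral_leadX i f : i \notin U -> f \in ideal_of X ->
  poly_in (i |: U) f -> f != 0 ->
  integralOver res (pr (lead_coef (uni i f) * 'X_i)).
Proof.
move=> iU fX fiU f0; set p := uni i f; set c := lead_coef p.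
have pU j : poly_in U p`_j by exact: uni_coef_in fiU.
have p0 : p != 0 by rewrite uni_eq0.
(* The degree in X_i is positive: a relation free of X_i would lie in K[U], hence be 0. *)
have [n sz_p] : exists n, size p = n.+2.
  have : size p != 0%N by rewrite size_poly_eq0.
  have : size p != 1%N.
    apply: contra f0 => /size_poly1P[g g0 pE].
    apply/eqP; apply: (X_U fX).
    by rewrite -(horner_uni i f) -/p pE hornerC; have := pU 0%N; rewrite pE coefC.
  by case: (size p) => [|[|n]] // _ _; exists n.
have cE : c = p`_n.+1 by rewrite /c /lead_coef sz_p.
pose q := 'X^(n.+1) + \poly_(j < n.+1) (p`_j * c ^+ (n - j)).
exists q; first by rewrite monicE lead_coefDl ?lead_coefXn // size_polyXn ltnS size_poly.
have qU j : poly_in U q`_j.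
  rewrite coefD coefXn coef_poly; apply: poly_inD; first exact: poly_in_nat.
  case: ifP => _; last exact: (poly_in_nat _ _ 0).
  by apply: poly_inM => //; apply: poly_in_exp; rewrite cE.
rewrite map_poly_res // rootE horner_map pr_eq0.
have -> : q.[c * 'X_i] = c ^+ n * f.
  rewrite -(horner_uni i f) -/p hornerD hornerXn horner_poly horner_coef sz_p.
  rewrite [in RHS]big_ord_recr /= -cE mulrDr mulr_sumr addrC exprMn [c ^+ n.+1]exprSr.
  rewrite mulrA; congr (_ + _); apply: eq_bigr => j _.
  rewrite exprMn [LHS]mulrA -[_ * _ * c ^+ j]mulrA -exprD subnK ?leq_ord //.
  by rewrite [RHS]mulrCA mulrA.
exact: idealM.
Qed.

Hypothesis U_max : forall i, i \notin U ->
  exists f, [/\ f \in ideal_of X, poly_in (i |: U) f & f != 0].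

(** The product of the leading coefficients of the relations serves all variables at once, its extra
    factors being in K[U]. *)
Lemma common_denominator : exists s, [/\ s != 0, poly_in U s &
  forall i, integralOver res (pr (s * 'X_i))].
Proof.
have /choice[t tP] i : exists t, [/\ t != 0, poly_in U t &
    integralOver res (pr (t * 'X_i))].
  have [iU|iU] := boolP (i \in U).
    exists 1; rewrite oner_neq0 mul1r; split=> //; first exact: (poly_in_nat _ _ 1).
    by apply: integral_in; exact: poly_inX.
  have [f [fX fU f0]] := U_max iU; exists (lead_coef (uni i f)).
  split; [by rewrite lead_coef_eq0 uni_eq0|exact: uni_coef_in fU|].
  exact: integral_leadX fU f0.
exists (\prod_i t i); split.
- by apply/prodf_neq0 => i _; have [] := tP i.
- by apply: poly_in_prod => i _; have [] := tP i.
move=> i; rewrite (bigD1 i) //= mulrAC rmorphM; apply: integral_mul.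
  by have [] := tP i.
by apply: integral_in; apply: poly_in_prod => j _; have [] := tP j.
Qed.

(** The polynomials made integral by some power of [s] are closed under sums and products, and
    include the constants and the variables. *)
Lemma integral_scaled s h : poly_in U s ->
  (forall i, integralOver res (pr (s * 'X_i))) ->
  exists k, integralOver res (pr (s ^+ k * h)).
Proof.
move=> sU sX; pose Q g := exists k, integralOver res (pr (s ^+ k * g)).
have intX k : integralOver res (pr (s ^+ k)).
  by apply: integral_in; exact: poly_in_exp.
have QC c : Q c%:MP.
  by exists 0%N; rewrite mul1r; apply: integral_in; exact: poly_inC.
have QD f g : Q f -> Q g -> Q (f + g).
  move=> [k fk] [l gl]; exists (k + l)%N; rewrite mulrDr rmorphD.
  apply: integral_add; first by rewrite exprD mulrAC rmorphM; exact: integral_mul fk (intX l).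
  by rewrite exprD -mulrA rmorphM; exact: integral_mul (intX k) gl.
have QM f g : Q f -> Q g -> Q (f * g).
  move=> [k fk] [l gl]; exists (k + l)%N.
  by rewrite exprD mulrACA rmorphM; exact: integral_mul fk gl.
have QX f n : Q f -> Q (f ^+ n).
  by move=> Qf; elim: n => [|n IH]; [exact: (QC 1)|rewrite exprS; exact: QM].
rewrite (mpolyE h); apply: (big_ind Q); [by rewrite -mpolyC0|exact: QD|].
move=> b _; rewrite -mul_mpolyC mpolyXE_id; apply: (QM); first exact: QC.
apply: (big_ind Q); [by rewrite -mpolyC1|exact: QM|] => i _.
by apply: QX; exists 1%N; rewrite expr1.
Qed.

(* Over K[U] localized at the common denominator s the quotient is integral,
   so X_u - c can divide a nonzero element of K[U \ u] only if s vanishes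
   at X_u = c. *)
Lemma independent_slice u : u \in U ->
  exists c, independent (inter X (hypersurface ('X_u - c%:MP))) (U :\ u).
Proof.
move=> uU; have [s [s0 sU sX]] := common_denominator.
have [c sc0] : exists c : K, (uni u s).[c%:MP] != 0.
  by apply: exists_nonroot_const; rewrite uni_eq0.
exists c => g /asboolP[f [_ [fX /asboolP[h ->] gE]]] gU.
have [k [p p_monic p_root]] := integral_scaled h sU sX.
pose q := map_poly (restr U) p.
have q_monic : q \is monic by exact: monic_map.
have qX : q.[s ^+ k * h] \in ideal_of X.
  by rewrite -pr_eq0 -horner_map -map_poly_comp.
have qU j : poly_in U q`_j by rewrite coef_map; exact: poly_in_restr.
have [n sz_q] : exists n, size q = n.+1.
  by exists (size q).-1; rewrite polySpred // monic_neq0.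
have qn : q`_n = 1 by have /monicP := q_monic; rewrite /lead_coef sz_q.
pose a : {mpoly K[m]} := 'X_u - c%:MP.
have aU : poly_in U a by apply: poly_inB; [exact: poly_inX|exact: poly_inC].
have gU' : poly_in U g by apply: poly_inS gU; exact: subsetDl.
(* Multiplying the equation of s^k h by a^n lets g replace a h: [w] is a^n q(s^k h) modulo the
   ideal, yet has all its factors in K[U]. *)
pose w := \sum_(j < n.+1) q`_j * a ^+ (n - j) * (s ^+ k * g) ^+ j.
have prg : pr g = pr (h * a).
  have prf : pr f = 0 by apply/eqP; rewrite pr_eq0.
  by rewrite gE [LHS]rmorphD prf add0r.
have wX : w \in ideal_of X.
  rewrite -pr_eq0.
  have -> : pr w = pr (a ^+ n * q.[s ^+ k * h]).
    rewrite horner_coef sz_q mulr_sumr !rmorph_sum; apply: eq_bigr => j _.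
    have -> : pr (q`_j * a ^+ (n - j) * (s ^+ k * g) ^+ j) =
              pr (q`_j * a ^+ (n - j) * (s ^+ k * (h * a)) ^+ j).
      by rewrite rmorphM rmorphXn [pr (s ^+ k * g)]rmorphM prg -rmorphM -rmorphXn -rmorphM.
    have -> : a ^+ n = a ^+ (n - j) * a ^+ j by rewrite -exprD subnK ?leq_ord.
    by congr (pr _); rewrite mulrA [in LHS]exprMn mulrACA [RHS]mulrC.
  by rewrite pr_eq0; exact: idealM.
have w0 : w = 0.
  apply: X_U wX _; apply: poly_in_sum => j _.
  by apply: poly_inM; [apply: poly_inM|]; rewrite ?poly_in_exp ?poly_inM ?poly_in_exp.
(* Setting X_u = c fixes [g] and kills [a]. Only the top term (s^k g)^n of [w] survives, so it is 0;
   as s does not vanish at X_u = c, g is 0. *)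
pose ev : {rmorphism {mpoly K[m]} -> {mpoly K[m]}} :=
  horner_eval (c%:MP : {mpoly K[m]}) \o uni u.
have evg : ev g = g.
  by rewrite /ev /= (uni_const _ gU) ?inE ?eqxx // /horner_eval hornerC.
have eva : ev a = 0.
  by rewrite /ev /= rmorphB uniXU eqxx uniC /horner_eval !hornerE subrr.
have : ev w = 0 by rewrite w0 rmorph0.
rewrite /w big_ord_recr rmorphD rmorph_sum big1 => [|j _]; last first.
  by rewrite !rmorphM rmorphXn eva expr0n /= subn_eq0 leqNgt ltn_ord mulr0 mul0r.
rewrite add0r [nat_of_ord ord_max]/= subnn expr0 qn !mul1r => /eqP.
by rewrite rmorphXn rmorphM rmorphXn evg !expf_eq0 mulf_eq0 !expf_eq0 (negPf sc0) andbF
   => /andP[_ /eqP].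
Qed.

End Slicing.

Lemma exists_subset_card (T : finType) (A : {set T}) n : (n <= #|A|)%N ->
  exists2 B : {set T}, B \subset A & #|B| = n.
Proof.
rewrite -bin_gt0 -cards_draws => /card_gt0P[B]; rewrite inE => /andP[BA /eqP].
by exists B.
Qed.

Section Dimension.
Variables (K : closedFieldType) (m : nat).
Implicit Types (X : subscheme K m) (U V : {set 'I_m}) (f g : {mpoly K[m]}).

Lemma exists_max_independent X U : independent X U ->
  exists V, [/\ U \subset V, independent X V &
    forall W, independent X W -> (#|W| <= #|V|)%N \/ ~~ (V \subset W)].
Proof.
move=> iU.
have [V /maxsetP[/asboolP iV Vmax] UV] :=
  @maxset_exists _ (fun V => `[< independent X V >]) U (introT (asboolP _) iU).
exists V; split=> // W iW; have [VW|] := boolP (V \subset W); last by right.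
by left; rewrite (Vmax W) //; exact/asboolP.
Qed.

Lemma prime_chain_independent n X U : independent X U -> #|U| = n ->
  prime_chain X n.+1.
Proof.
elim: n X U => [|n IH] X U iU Un; have [P [XP PU]] := prime_over iU.
  by exists (fun=> P); split=> [//|i j]; rewrite !ord1.
pose Y := Subscheme (prime_ideal_closed P).
(* Slicing requires a maximal set. It may be larger than [U], so after the slice only a subset [W]
   of size n is kept. *)
have [V [UV iV Vmax]] := @exists_max_independent Y U PU.
have [u uV] : exists u, u \in V.
  apply/finset.set0Pn; rewrite -card_gt0; apply: leq_trans (subset_leq_card UV).
  by rewrite Un.
have relation i : i \notin V ->
    exists f, [/\ f \in ideal_of Y, poly_in (i |: V) f & f != 0].
  move=> iNV; apply: contrapT => no_f.
  have /Vmax : independent Y (i |: V).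
    move=> f fY fV; apply/eqP/negPn/negP => f0; apply: no_f; by exists f.
  by rewrite cardsU1 iNV ltnn finset.subsetUr => -[].
have [c iVc] := independent_slice iV relation uV.
set Z := inter _ _ in iVc.
have [W WV Wn] : exists2 W : {set 'I_m}, W \subset V :\ u & #|W| = n.
  apply: exists_subset_card.
  by have := subset_leq_card UV; rewrite Un (cardsD1 u V) uV.
have [Q [ZQ Qlt]] := IH Z W (independentS WV iVc) Wn.
have PQ i : {subset (P : pred _) <= (Q i : pred _)}.
  by move=> f fP; apply: ZQ; apply: sub_inter.
exists (fun i => if unlift ord0 i is Some j then Q j else P); split.
  move=> i f fX; case: unliftP => [j _|_]; last exact: XP.
  exact/PQ/XP.
move=> i j; case: unliftP => [i' ->|->]; case: unliftP => [j' ->|->] //.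
  by rewrite !lift0 ltnS; exact: Qlt.
move=> _; split; first exact: PQ.
(* This element makes the inclusion of [P] strict: it is a nonzero element of K[V], and [P] meets
   K[V] only in 0. *)
exists ('X_u - c%:MP); first by apply: ZQ; exact: ideal_inter_hypersurface.
apply/negP => /(iV _) h.
have : uni u ('X_u - c%:MP : {mpoly K[m]}) = 0.
  by rewrite h ?rmorph0 //; apply: poly_inB; [exact: poly_inX|exact: poly_inC].
by rewrite rmorphB uniXU eqxx uniC => /eqP; rewrite polyXsubC_eq0.
Qed.

End Dimension.

(** * Counting patterns *)

(* A family of functions that is triangular on its own witnesses is linearly
   independent, so it has no more members than a spanning set. *)
Lemma triangular_card (K : fieldType) (T J : finType) (A : {set T}) (B : {set J})
    (G : T -> T -> K) (c : T -> J -> K) (e : J -> T -> K) (rk : T -> nat) :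
  {in A &, forall s t, G s t = \sum_(j in B) c s j * e j t} ->
  {in A, forall s, G s s != 0} ->
  {in A &, forall s t, s != t -> G s t != 0 -> (rk s < rk t)%N} ->
  (#|A| <= #|B|)%N.
Proof.
move=> Gce Gdiag Gtri.
pose M := \matrix_(i < #|A|, j < #|B|) c (enum_val i) (enum_val j).
pose M' := \matrix_(j < #|B|, i < #|A|) e (enum_val j) (enum_val i).
have MM'E i i' : (M *m M') i i' = G (enum_val i) (enum_val i').
  rewrite mxE Gce ?enum_valP // [RHS]big_enum_val.
  by apply: eq_bigr => j _; rewrite !mxE.
suff /eqP <- : row_free (M *m M') by exact: mulmx_max_rank.
apply: inj_row_free => v vM; apply/eqP; apply: contraT => /rV0Pn[i0 vi0].
(* At a nonzero coordinate of [v] of least rank, triangularity leaves only the diagonal term in the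
   product. *)
have [i vi imin] := @arg_minnP _ i0 [pred i | v 0 i != 0] (rk \o enum_val) vi0.
have /eqP : (v *m (M *m M')) 0 i = 0 by rewrite vM mxE.
rewrite mxE (bigD1 i) //= big1 => [|j ji]; last first.
  rewrite MM'E; have [->|vj] := eqVneq (v 0 j) 0; first by rewrite mul0r.
  have [->|Gji] := eqVneq (G (enum_val j) (enum_val i)) 0; first by rewrite mulr0.
  have ji' : enum_val j != enum_val i by rewrite (inj_eq enum_val_inj).
  have := Gtri _ _ (enum_valP j) (enum_valP i) ji' Gji.
  by rewrite ltnNge (imin j vj).
by rewrite addr0 MM'E mulf_eq0 (negPf vi) (negPf (Gdiag _ (enum_valP i))).
Qed.

(** * Sparse monomials: their number, and reduction to them modulo the ideal *)

Section Sparse.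
Variables (m r E : nat).

Definition sparse (b : 'X_{1..m}) := (#|[set i | (E <= b i)%N]| <= r)%N.

(** A sparse monomial is recovered from the positions of its large exponents, their at most r
    values, padded with 0, and its small exponents, with 0 at the large positions. The three factors
    count these data. *)
Lemma card_sparse n :
  (#|[set b : 'X_{1..m < n.+1} | sparse b]| <= 2 ^ m * (n.+1 ^ r * E.+1 ^ m))%N.
Proof.
pose big (b : 'X_{1..m}) := [set i | (E <= b i)%N].
pose codeT : finType :=
  ({set 'I_m} * ({ffun 'I_r -> 'I_n.+1} * {ffun 'I_m -> 'I_E.+1}))%type.
pose code (b : 'X_{1..m < n.+1}) : codeT :=
  (big b, ([ffun j : 'I_r => inord (nth 0%N [seq b i | i <- enum (big b)] j)],
           [ffun i => inord (if i \in big b then 0%N else b i)])).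
have le_deg (b : 'X_{1..m < n.+1}) i : (b i < n.+1)%N.
  apply: leq_ltn_trans (bmdeg b); rewrite mdegE (bigD1 i) //=; exact: leq_addr.
have code_inj : {in [set b : 'X_{1..m < n.+1} | sparse b] &, injective code}.
  move=> a b; rewrite !inE => sp_a _ [eq_big /ffunP eq1 /ffunP eq2].
  apply/val_inj/mnmP => i /=.
  have [ia|ia] := boolP (i \in big a).
    have idx : (index i (enum (big a)) < r)%N.
      by apply: leq_trans sp_a; rewrite cardE index_mem mem_enum.
    have := eq1 (Ordinal idx); rewrite !ffunE /= -eq_big.
    rewrite !(nth_map i) ?nth_index ?mem_enum ?index_mem ?mem_enum //.
    by move=> /(congr1 val); rewrite /= !inordK.
  have := eq2 i; rewrite !ffunE -eq_big (negPf ia) => /(congr1 val).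
  have ib : i \notin big b by rewrite -eq_big.
  have small d : i \notin big d -> (d i < E.+1)%N.
    by rewrite inE -ltnNge ltnS; exact: ltnW.
  by rewrite /= !inordK ?small.
apply: leq_trans (@leq_card_in _ codeT code _ code_inj) _.
by rewrite !card_prod !card_ffun -(cardsT {set 'I_m}) -powersetT card_powerset cardsT !card_ord.
Qed.

Variables (K : closedFieldType) (X : subscheme K m).
Implicit Types f g : {mpoly K[m]}.

Definition reducible n f := exists g, f - g \in ideal_of X /\
  {in msupp g, forall b, sparse b /\ (mdeg b <= n)%N}.

Lemma reducible0 n : reducible n 0.
Proof. by exists 0; rewrite subr0 msupp0; split=> //; exact: ideal0. Qed.

Lemma reducibleD n f g : reducible n f -> reducible n g -> reducible n (f + g).
Proof.
move=> [f' [fX f's]] [g' [gX g's]]; exists (f' + g'); split.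
  by rewrite opprD addrACA; exact: idealD.
by move=> b /msuppD_le; rewrite mem_cat => /orP[/f's|/g's].
Qed.

Lemma reducibleZ n a f : reducible n f -> reducible n (a *: f).
Proof.
move=> [f' [fX f's]]; exists (a *: f'); split.
  by rewrite -scalerBr -mul_mpolyC; exact: idealM.
by move=> b /msuppZ_le /f's.
Qed.

Lemma reducible_sum n (I : eqType) (s : seq I) (P : pred I) (F : I -> {mpoly K[m]}) :
  (forall i, i \in s -> P i -> reducible n (F i)) ->
  reducible n (\sum_(i <- s | P i) F i).
Proof.
move=> h; rewrite big_seq_cond; apply: big_ind.
- exact: reducible0.
- exact: reducibleD.
- by move=> i /andP[]; exact: h.
Qed.

Lemma reducibleW n n' f : (n <= n')%N -> reducible n f -> reducible n' f.
Proof.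
move=> nn' [g [fg gs]]; exists g; split=> // b /gs[sb bn]; split=> //.
exact: leq_trans nn'.
Qed.

Lemma reducible_mod n f g : f - g \in ideal_of X -> reducible n g -> reducible n f.
Proof.
move=> fg [h [gh hs]]; exists h; split=> //.
by rewrite -(subrK g f) -addrA; exact: idealD.
Qed.

Hypothesis dependent : forall V : {set 'I_m}, #|V| = r.+1 -> exists f,
  [/\ f \in ideal_of X, poly_in V f, f != 0 & (msize f <= E)%N].

(* A monomial with more than r large exponents is a multiple of the leading
   monomial of one of the given relations. *)
Lemma reducible_monomial b : reducible (mdeg b) 'X_[b].
Proof.
elim/(well_founded_ind (@ltom_wf m)): b => b IH.
have [sb|] := boolP (sparse b).
  exists 'X_[b]; rewrite subrr; split; first exact: ideal0.
  by move=> b'; rewrite msuppX inE => /eqP ->.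
rewrite -ltnNge => /exists_subset_card[V Vbig /dependent[f [fX fV f0 fE]]].
set l := mlead f; have lf : l \in msupp f by exact: mlead_supp.
(* Off [V] the exponents of [l] are 0; on [V] they are below [E], while those of [b] are at least
   [E]. *)
have lb : (l <= b)%MM.
  apply/mnm_lepP => i; have [iV|iV] := boolP (i \in V); last first.
    by rewrite (mem_msupp_poly_in fV).
  have := fintype.subsetP Vbig _ iV; rewrite inE; apply: leq_trans.
  apply: leq_trans fE; apply: ltnW; apply: leq_ltn_trans (msize_mdeg_lt lf).
  by rewrite mdegE (bigD1 i) //= leq_addr.
pose t := (b - l)%MM; have bE : b = (t + l)%MM by rewrite submK.
pose c := (f@_l)^-1; have fl0 : f@_l != 0 by rewrite mleadc_eq0.
(* This is X^b - c X^t f: the leading terms cancel, leaving smaller monomials, whose degree is no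
   larger since the order is graded. *)
pose g := \sum_(b' <- msupp f | b' != l) (- c * f@_b') *: 'X_[t + b'] : {mpoly K[m]}.
apply: (@reducible_mod _ _ g).
  suff -> : 'X_[b] - g = (c *: 'X_[t]) * f by exact: idealM.
  rewrite [in RHS](mpolyE f) (bigD1_seq l) ?msupp_uniq //= mulrDr.
  rewrite -scalerAl -scalerAr scalerA mulVf // scale1r -mpolyXD -bE; congr (_ + _).
  rewrite /g -sumrN mulr_sumr; apply: eq_bigr => b' _.
  by rewrite mulNr scaleNr opprK -scalerAl -scalerAr scalerA -mpolyXD.
apply: reducible_sum => b' b'f b'l; apply: reducibleZ.
have lt_b : ((t + b')%MM < b)%O.
  by rewrite bE ltmc_add2r lt_neqAle b'l /=; exact: msupp_le_mlead.
by apply: reducibleW (IH _ lt_b); apply: lemc_mdeg; exact: ltW.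
Qed.

Lemma reducible_msize n f : (msize f <= n.+1)%N -> reducible n f.
Proof.
move=> fn; rewrite (mpolyE f); apply: reducible_sum => b bf _; apply: reducibleZ.
apply: reducibleW (reducible_monomial b); rewrite -ltnS.
exact: leq_trans (msize_mdeg_lt bf) fn.
Qed.

End Sparse.

(** * Bounding the patterns by the sparse monomials *)

Section Patterns.
Variables (K : closedFieldType) (m : nat) (X : subscheme K m).
Implicit Types f g : {mpoly K[m]}.

Lemma points_inter_hypersurface f x : points X x ->
  (points (inter X (hypersurface f)) x <-> f.@[x] = 0).
Proof.
move=> xX; split=> [|fx0 g].
  by apply; exact: ideal_inter_hypersurface.
by move=> /asboolP[a [_ [aX /asboolP[h ->] ->]]]; rewrite mevalD mevalM fx0 (xX a) // mulr0 addr0.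
Qed.

Lemma msize_prod_le D (I : Type) (s : seq I) (P : pred I) (F : I -> {mpoly K[m]}) :
  (forall i, (msize (F i) <= D.+1)%N) ->
  (msize (\prod_(i <- s | P i) F i) <= (size s * D).+1)%N.
Proof.
move=> FD; elim: s => [|i s IH]; first by rewrite big_nil msize1.
rewrite big_cons; case: ifP => _ /=; last by apply: leq_trans IH _; rewrite ltnS leq_addl.
set g := \prod_(_ <- _ | _) _ in IH *.
have [->|Fi0] := eqVneq (F i) 0; first by rewrite mul0r msize0.
have [->|g0] := eqVneq g 0; first by rewrite mulr0 msize0.
rewrite msizeM // mulSn.
by rewrite -subn1 leq_subLR add1n -addnS -addSn; exact: leq_add (FD i) IH.
Qed.

(** On X(K) only the class modulo the ideal matters. The sum has the shape that [triangular_card]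
    takes as a factorization. *)
Lemma reducible_meval r E n f : reducible r E X n f ->
  exists c : 'X_{1..m < n.+1} -> K, forall y, points X y ->
    f.@[y] = \sum_(b in [set b : 'X_{1..m < n.+1} | sparse r E b])
      c b * \prod_i y i ^+ b i.
Proof.
move=> [g [fgX gs]]; exists (fun b => g@_b) => y yX.
have -> : f.@[y] = g.@[y].
  by apply/eqP; rewrite -subr_eq0 -mevalB; apply/eqP; exact: yX.
have gn : (msize g <= n.+1)%N.
  by rewrite msizeE; apply/bigmax_leqP_seq => b /gs[].
rewrite {1}(mpolywE gn) rmorph_sum (bigID (mem [set b : 'X_{1..m < n.+1} | sparse r E b])) /=.
rewrite [X in _ + X]big1 => [|b]; last first.
  rewrite inE => sb; rewrite memN_msupp_eq0 ?scale0r ?rmorph0 //.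
  by apply: contra sb => /gs[].
by rewrite addr0; apply: eq_bigr => b _; rewrite mevalZ mevalX.
Qed.

Lemma pattern_count_le_sparse r E D N (F : 'I_N -> {mpoly K[m]}) :
  (forall n f, (msize f <= n.+1)%N -> reducible r E X n f) ->
  (forall i, (msize (F i) <= D.+1)%N) ->
  (pattern_count X [fset inter X (hypersurface (F i)) | i : 'I_N]%fset
    <= #|[set b : 'X_{1..m < (N * D).+1} | sparse r E b]|)%N.
Proof.
move=> red FD; set S := [fset _ | _ in _]%fset; rewrite /pattern_count.
have /choice[x xP] (s : {ffun S -> bool}) :
    exists x, s \in realizable_patterns X S -> pattern_set X s x.
  have [|sS] := boolP (s \in realizable_patterns X S).
    by rewrite inE => /asboolP[x xs]; exists x.
  by exists (fun=> 0).
have xX s : s \in realizable_patterns X S -> points X (x s) by move=> /xP[].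
pose supp s := [set i | (F i).@[x s] != 0].
(* Several indices may define the same member [Y] of [S]; any one of them decides whether a point of
   X(K) lies on [Y]. *)
have supp_inj : {in realizable_patterns X S &, injective supp}.
  move=> s t sS tS /setP st; apply/ffunP => Y.
  have /imfsetP[i _ YE] := valP Y.
  have vanish u : u \in realizable_patterns X S ->
      (u Y = true <-> (i \in supp u) = false).
    move=> uS; have [_ /(_ Y) <-] := xP u uS; rewrite YE.
    rewrite points_inter_hypersurface; last exact: xX.
    by rewrite inE; split=> [->|/negbFE/eqP]; rewrite ?eqxx.
  apply/idP/idP => [/(vanish s sS)|/(vanish t tS)].
    by rewrite st => /(vanish t tS).
  by rewrite -st => /(vanish s sS).
pose g s := \prod_(i in supp s) F i.
have gE s t : (g s).@[x t] = \prod_(i in supp s) (F i).@[x t] by rewrite rmorph_prod.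
have g_red s : reducible r E X (N * D) (g s).
  apply: red; apply: leq_trans (msize_prod_le _ _ FD) _.
  by rewrite /index_enum -enumT size_enum_ord.
have /choice[c cP] s := reducible_meval (g_red s).
(* If g_s(x_t) is nonzero then supp s is contained in supp t, strictly when s and t differ, so the
   size of the support serves as rank. *)
apply: (@triangular_card _ _ _ _ _ (fun s t => (g s).@[x t]) c
  (fun b t => \prod_i x t i ^+ b i) (fun s => #|supp s|)).
- by move=> s t sS tS; rewrite cP //; exact: xX.
- by move=> s sS; rewrite gE; apply/prodf_neq0 => i; rewrite inE.
- move=> s t sS tS st; rewrite gE => /prodf_neq0 h.
  apply: proper_card; rewrite finset.properEneq; apply/andP; split.
    by apply: contra st => /eqP/supp_inj ->.
  by apply/fintype.subsetP => i /h; rewrite inE.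
Qed.

End Patterns.

Theorem theorem3p3 (R : realType) (K : closedFieldType) (m : nat)
    (X : subscheme K m) (D : nat) (d : int) (dimX : has_dim X d) :
  exists2 C : R, 0 < C &
    forall (N : nat) (F : 'I_N -> {mpoly K[m]}),
      (0 < N)%N -> (forall i, (msize (F i) <= D.+1)%N) ->
      (pattern_count X
         [fset inter X (hypersurface (F i)) | i : 'I_N]%fset)%:R
        <= C * N%:R ^ d.
Proof.
have [n [dE _ nmax]] := dimX.
(* The empty subscheme has no pattern, so C = 1 works whatever the sign of the exponent. *)
have [X1|X1] := boolP (1 \in ideal_of X).
  exists 1 => // N F N0 FD; rewrite /pattern_count (_ : realizable_patterns _ _ = finset.set0).
    by rewrite cards0 mul1r exprz_ge0.
  apply/setP => s; rewrite !inE; apply/asboolPn => -[x [xX _]].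
  by have /eqP := xX _ X1; rewrite meval1 oner_eq0.
have i0 : independent X finset.set0.
  move=> f fX /poly_in0 fE; apply/eqP; apply: contraNT X1 => f0.
  have c0 : f@_0 != 0 by move: f0; rewrite {1}fE mpolyC_eq0.
  have -> : 1 = (f@_0)^-1%:MP * f by rewrite {2}fE -mpolyCM mulVf.
  exact: idealM.
have [U iU Umax] := @arg_maxnP _ finset.set0 (fun U => `[< independent X U >])
  (fun U => #|U|) (introT (asboolP _) i0).
set r := #|U| in Umax.
(* The chain of r + 1 primes gives r <= n - 1 = dim X. *)
have rn : (r < n)%N by apply/nmax/(prime_chain_independent (asboolW iU)).
have /choice[f fP] (V : {set 'I_m}) : exists f, #|V| = r.+1 ->
    [/\ f \in ideal_of X, poly_in V f & f != 0].
  have [Vr|Vr] := eqVneq #|V| r.+1; last by exists 0 => /eqP; rewrite (negPf Vr).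
  apply: contrapT => /forallNP h.
  have : independent X V.
    move=> f fX fV; apply/eqP/negPn/negP => f0; by apply: (h f).
  by move=> /asboolT /Umax; rewrite /= Vr /r ltnn.
(* The relations are chosen before the F_i, so [E] depends on [X] alone. *)
pose E := (\max_V msize (f V))%N.
have red k g : (msize g <= k.+1)%N -> reducible r E X k g.
  apply: reducible_msize => V Vr; have [fX fV f0] := fP V Vr.
  by exists (f V); split=> //; exact: (leq_bigmax V).
(* For N > 0, (N D + 1)^r is at most (D + 1)^r N^r, and N^r at most N^(dim X); the other factors
   come from [card_sparse]. *)
pose C := (2 ^ m * (D.+1 ^ r * E.+1 ^ m))%N.
exists C%:R; first by rewrite ltr0n !muln_gt0 !expn_gt0.
move=> N F N0 FD; have -> : d = n.-1%:Z by rewrite dE; lia.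
rewrite -exprnP -natrX -natrM ler_nat.
apply: leq_trans (pattern_count_le_sparse red FD) _.
apply: leq_trans (card_sparse _ _ _ _) _.
rewrite /C -mulnA leq_mul2l; apply/orP; right.
rewrite mulnAC leq_mul2r; apply/orP; right.
have base : ((N * D).+1 <= D.+1 * N)%N by rewrite mulSn mulnC -add1n leq_add2r.
have [->|r0] := posnP r; first by rewrite !expn0 mul1n expn_gt0 N0.
apply: (@leq_trans ((D.+1 * N) ^ r)).
  by rewrite leq_exp2r.
by rewrite expnMn leq_mul2l leq_pexp2l ?orbT //; lia.
Qed.
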